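(* Let $n\ge 3$, $K=\mathbb R^n_+$, $d\in\mathbb R^n$, and let $A=\operatorname{diag}(d)$ be a diagonal matrix such that there exist $i_0,j_0\in\operatorname{argmin}\{d_i:i\in[n]\}$ with $i_0\ne j_0$. Let $b=(b_1,\dots,b_n)^\top\in\mathbb R^n$, $c\in\mathbb R$, and let $f:\mathbb S^n\cap\operatorname{int}(K)\to\mathbb R$ be defined by $f(x)=\langle Ax,x\rangle+\langle b,x\rangle+c$. Then $f$ is spherically convex if and only if $$b_i\le 2\left[\min(d_1,\dots,d_n)-d_i\right]$$ for all $i\in[n]$.
   Context: $\langle x,y\rangle=x^\top y$ is the canonical inner product on $\mathbb R^n$, $\|\cdot\|$ the Euclidean norm, $\mathbb S^n=\{x\in\mathbb R^n:\|x\|=1\}$, $[n]=\{1,\dots,n\}$, $\mathbb R^n_+$ is the nonnegative orthant. $\operatorname{diag}(d)$ is the diagonal matrix with diagonal entries $d_1,\dots,d_n$. $\operatorname{argmin}\{d_i:i\in[n]\}$ is the set of indices at which $d_i$ is minimal. Geodesics of $\mathbb S^n$ are great circles (intersections of $\mathbb S^n$ with two-dimensional subspaces); a minimal geodesic segment is a shortest great-circle arc joining two points, parametrized proportionally to arc length. A function $f:\mathbb S^n\cap\operatorname{int}(K)\to\mathbb R$ is spherically convex if for every minimal geodesic segment $\gamma:J\to\mathbb S^n\cap\operatorname{int}(K)$ ($J$ an interval), the composition $f\circ\gamma$ is convex on $J$. *)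

(* Defs.v *)
From HB Require Import structures.
From mathcomp Require Import all_boot all_order all_algebra.
From mathcomp Require Import all_classical all_reals all_analysis.
Set Implicit Arguments.
Unset Strict Implicit.
Unset Printing Implicit Defensive.
Import Order.TTheory GRing.Theory Num.Theory.
Import numFieldNormedType.Exports.
Local Open Scope classical_set_scope.
Local Open Scope ring_scope.

Definition inner (R : realType) (n : nat) (x y : 'cV[R]_n) : R :=
  (x^T *m y) 0 0.

(* The norm `|x| that the library puts on matrices is the sup norm. *)
Definition enorm (R : realType) (n : nat) (x : 'cV[R]_n) : R :=
  Num.sqrt (inner x x).

Definition sphere (R : realType) (n : nat) : set 'cV[R]_n :=
  [set x | enorm x = 1].
Arguments sphere R n : clear implicits.

Definition orthant (R : realType) (n : nat) : set 'cV[R]_n :=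
  [set x | forall i, 0 <= x i 0].
Arguments orthant R n : clear implicits.

Definition great_circle (R : realType) (n : nat) (C : set 'cV[R]_n) : Prop :=
  exists2 W : {vspace 'cV[R]_n},
    (\dim W = 2)%N & C = sphere R n `&` [set x | x \in W].

(* On J, g runs along a great circle at constant angular speed w.  Since the
   circle has radius 1, the length of g over [s, t] is w * (t - s).  The value
   w = 0 gives the constant curves, i.e. the arcs joining a point to itself.
   Only the values of g on J matter. *)
Definition great_circle_arc (R : realType) (n : nat)
    (J : set R) (w : R) (g : R -> 'cV[R]_n) : Prop :=
  0 <= w /\
  exists C : set 'cV[R]_n, great_circle C /\
  exists p v : 'cV[R]_n,
    [/\ C p, C v, inner p v = 0 &
        forall t, J t -> g t = cos (w * t) *: p + sin (w * t) *: v].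

(* J is any interval, compact or not.  For J = [a, b] the condition on all
   s <= t follows from the one for s = a and t = b, since a sub-arc of a
   shortest arc is shortest: g is then a shortest great-circle arc from g a
   to g b. *)
Definition minimal_geodesic_segment (R : realType) (n : nat)
    (J : set R) (g : R -> 'cV[R]_n) : Prop :=
  is_interval J /\
  exists2 w : R, great_circle_arc J w g &
    forall s t, J s -> J t -> s <= t ->
    forall (a b w' : R) (h : R -> 'cV[R]_n),
      a <= b -> great_circle_arc `[a, b] w' h -> h a = g s -> h b = g t ->
      w * (t - s) <= w' * (b - a).

Definition spherically_convex (R : realType) (n : nat)
    (D : set 'cV[R]_n) (f : 'cV[R]_n -> R) : Prop :=
  forall (J : set R) (g : R -> 'cV[R]_n),
    minimal_geodesic_segment J g -> (forall t, J t -> D (g t)) ->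
    @convex_function R R^o J (f \o g).

Definition argmin (R : realType) (n : nat) (d : 'cV[R]_n) : set 'I_n :=
  [set i | forall j, d i 0 <= d j 0].

(* Main.v *)
Require Import Defs.
From HB Require Import structures.
From mathcomp Require Import all_boot all_order all_algebra.
From mathcomp Require Import all_classical all_reals all_analysis.
From mathcomp Require Import ring lra.
Set Implicit Arguments.
Unset Strict Implicit.
Unset Printing Implicit Defensive.
Import Order.TTheory GRing.Theory Num.Theory.
Import numFieldNormedType.Exports.
Local Open Scope classical_set_scope.
Local Open Scope ring_scope.
(** Along a unit speed great circle with position x and velocity v, the second
derivative of f(x) = <Ax,x> + <b,x> + c is 2<Av,v> - 2<Ax,x> - <b,x>.  So f is
spherically convex on the part of the sphere inside an open set exactly when
    <b,x> <= 2 (<Av,v> - <Ax,x>)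
for every x in the domain and every unit v orthogonal to x.  If the inequality
holds, f is convex along every arc because its second derivative there is
nonnegative ([spherically_convex_of_second_order]).  Conversely, short arcs
centred at x with direction v are minimal, and convexity compared at the two
ends and the centre gives the inequality in the limit
([second_order_of_spherically_convex]).

For A = diag(d), let m be the least entry of d.  Since m is attained at two
indices i0 and j0, the eigenspace of m contains a plane, and this plane contains
a unit vector v orthogonal to any given x ([double_eigenvalue_orthogonal]).  Such
a v minimises <Av,v>, with value m, so v can be eliminated: f is
spherically convex if and only if <b,x> <= 2 (m - <Ax,x>) for all x in the
domain.  As |x| = 1, the right-hand side is the sum of 2 (m - d_i) x_i^2.
Letting x tend to the i-th basis vector gives b_i <= 2 (m - d_i)
([coordinate_bound_necessary]).  Conversely, if these bounds hold, then
b_i x_i <= 2 (m - d_i) x_i <= 2 (m - d_i) x_i^2, because 0 < x_i <= 1 and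
m - d_i <= 0 ([coordinate_bound_sufficient]). *)

(** * The inner product and the unit sphere *)

Lemma innerE (R : realType) (n : nat) (x y : 'cV[R]_n) :
  inner x y = \sum_i x i 0 * y i 0.
Proof. by rewrite /inner mxE; apply: eq_bigr => i _; rewrite mxE. Qed.

Lemma innerDl (R : realType) (n : nat) (x y z : 'cV[R]_n) :
  inner (x + y) z = inner x z + inner y z.
Proof. by rewrite /inner linearD mulmxDl mxE. Qed.

Lemma innerZl (R : realType) (n : nat) (a : R) (x y : 'cV[R]_n) :
  inner (a *: x) y = a * inner x y.
Proof. by rewrite /inner linearZ -scalemxAl mxE. Qed.

Lemma innerC (R : realType) (n : nat) (x y : 'cV[R]_n) :
  inner x y = inner y x.
Proof. by rewrite !innerE; apply: eq_bigr => i _; rewrite mulrC. Qed.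

Lemma innerDr (R : realType) (n : nat) (x y z : 'cV[R]_n) :
  inner x (y + z) = inner x y + inner x z.
Proof. by rewrite innerC innerDl !(innerC x). Qed.

Lemma innerZr (R : realType) (n : nat) (a : R) (x y : 'cV[R]_n) :
  inner x (a *: y) = a * inner x y.
Proof. by rewrite innerC innerZl innerC. Qed.

Lemma sphereE (R : realType) (n : nat) (x : 'cV[R]_n) :
  sphere R n x <-> inner x x = 1.
Proof.
have x_ge0 : 0 <= inner x x.
  by rewrite innerE sumr_ge0 // => i _; rewrite -expr2 sqr_ge0.
rewrite /sphere /= /enorm; split=> [|->]; last by rewrite sqrtr1.
by move=> x1; rewrite -[LHS]sqr_sqrtr // x1 expr1n.
Qed.

(** * Great-circle arcs *)

Definition unit_arc (R : realType) (n : nat) (p v : 'cV[R]_n) (t : R) :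
  'cV[R]_n := cos t *: p + sin t *: v.

Lemma inner_unit_arc (R : realType) (n : nat) (p v : 'cV[R]_n) (s t : R) :
  inner p p = 1 -> inner v v = 1 -> inner p v = 0 ->
  inner (unit_arc p v s) (unit_arc p v t) = cos (t - s).
Proof.
move=> pp vv pv; rewrite /unit_arc !(innerDl, innerDr, innerZl, innerZr).
by rewrite pp vv (innerC v) pv cosB; ring.
Qed.

(** Orthonormal vectors are linearly independent, so they span a plane. *)
Lemma great_circle_span (R : realType) (n : nat) (p v : 'cV[R]_n) :
  inner p p = 1 -> inner v v = 1 -> inner p v = 0 ->
  exists C, [/\ great_circle C, C p & C v].
Proof.
move=> pp vv pv.
exists (sphere R n `&` [set x | x \in <<[:: p; v]>>%VS]).
split; last 2 first.
- by split; [apply/sphereE|rewrite /= memv_span // mem_head].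
- by split; [apply/sphereE|rewrite /= memv_span // !inE eqxx orbT].
exists <<[:: p; v]>>%VS => //.
have inner0 (x : 'cV[R]_n) : inner x 0 = 0.
  by rewrite -(scale0r 0) innerZr mul0r.
apply/eqP; suff: free [:: p; v] by rewrite /free => /eqP ->.
rewrite free_cons seq1_free span_seq1; apply/andP; split; last first.
  apply/eqP => v0; move: vv; rewrite v0 inner0 => /esym /eqP.
  by rewrite oner_eq0.
apply/vlineP => -[k pE]; move: pp; rewrite {2}pE innerZr pv mulr0 => /esym /eqP.
by rewrite oner_eq0.
Qed.

Lemma great_circle_sphere (R : realType) (n : nat) (C : set 'cV[R]_n)
    (x : 'cV[R]_n) :
  great_circle C -> C x -> inner x x = 1.
Proof. by move=> [W _ ->] [/sphereE]. Qed.

(** The inner product of the two ends of an arc is the cosine of its length.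
The cosine is strictly decreasing on [0, pi], so an arc of length at most pi is
no longer than any other arc with the same ends. *)
Lemma minimal_unit_arc (R : realType) (n : nat) (p v : 'cV[R]_n) (J : set R) :
  inner p p = 1 -> inner v v = 1 -> inner p v = 0 ->
  is_interval J -> (forall s t, J s -> J t -> t - s <= pi) ->
  minimal_geodesic_segment J (unit_arc p v).
Proof.
move=> pp vv pv itvJ diamJ; split => //.
have [C [gcC Cp Cv]] := great_circle_span pp vv pv.
exists 1.
  split=> //; exists C; split=> //; exists p, v; split=> // t _.
  by rewrite mul1r.
move=> s t Js Jt st a b w' h ab [w'0 [C' [gcC' [q [u [Cq Cu qu hE]]]]]] ha hb.
have hE' x : x \in `[a, b] -> h x = unit_arc q u (w' * x).
  by move=> xab; rewrite hE.
have : cos (t - s) = cos (w' * (b - a)).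
  rewrite -(inner_unit_arc s t pp vv pv) -ha -hb !hE' ?in_itv /= ?lexx ?ab //.
  rewrite inner_unit_arc ?mulrBr //; exact: great_circle_sphere gcC' _.
rewrite mul1r leNgt => cosE; apply/negP => lt_len.
have : cos (t - s) < cos (w' * (b - a)).
  rewrite ltr_cos ?in_itv //=; last by rewrite subr_ge0 st diamJ.
  by rewrite mulr_ge0 ?subr_ge0 //= (le_trans (ltW lt_len)) // diamJ.
by rewrite cosE ltxx.
Qed.

(** * Convexity from the second derivative *)

(** The derivatives are taken of a function F defined on the whole line, and f
need only agree with it on J: a geodesic segment is only constrained there. *)
Lemma convex_function_derive2 (R : realType) (J : set R) (f F F1 F2 : R -> R) :
  is_interval J ->
  (forall t : R, is_derive t 1 F (F1 t)) ->
  (forall t : R, is_derive t 1 F1 (F2 t)) ->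
  (forall t, J t -> 0 <= F2 t) ->
  (forall t, J t -> f t = F t) ->
  @convex_function R R^o J f.
Proof.
move=> itvJ dF dF1 F2_ge0 fE.
have F'E : 'D_1 (F : R -> R^o) = F1 by apply/funext => t; exact: derive_val.
have contF : continuous F.
  by move=> t; apply: differentiable_continuous; apply/derivable1_diffP.
have convex_le (k : {i01 R}) (x y : R) : J x -> J y -> x <= y ->
    F (conv k (x : R^o) (y : R^o)) <= conv k (F x : R^o) (F y : R^o).
  move=> Jx Jy xy; apply: second_derivative_convex => //.
  - move=> t /andP[xt ty]; rewrite F'E.
    have -> : 'D_1 (F1 : R -> R^o) t = F2 t by exact: derive_val.
    apply/F2_ge0/(itvJ x y) => //.
    by rewrite !ltW.
  - by apply: cvg_at_left_filter; exact: contF.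
  - by apply: cvg_at_right_filter; exact: contF.
  - by move=> t _; rewrite F'E.
have convex_f (k : {i01 R}) (x y : convex_lmodType R^o) : J x -> J y ->
    x <= y -> f (conv k x y) <= conv k (f x : R^o) (f y : R^o).
  move=> Jx Jy xy.
  have Jk : J (conv k x y).
    apply: (itvJ x y) => //.
    by have := @convR_itv _ x y k xy; rewrite in_itv.
  by rewrite (fE _ Jk) (fE _ Jx) (fE _ Jy); exact: convex_le.
move=> k x y /set_mem Jx /set_mem Jy.
have [xy|/ltW yx] := leP (x : R) y; first exact: convex_f.
by rewrite convC [leRHS]convC; exact: convex_f.
Qed.

Lemma is_derive_cosM (R : realType) (w t : R) :
  is_derive t 1 (fun t => cos (w * t)) (- (w * sin (w * t))).
Proof.
have dw : is_derive t 1 (fun t : R => w * t) w.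
  by apply: is_derive_eq; rewrite /GRing.scale /= mulr1.
apply: (is_derive_eq (is_derive1_comp (f := cos) _ dw)).
by rewrite mulNr mulrC.
Qed.

Lemma is_derive_sinM (R : realType) (w t : R) :
  is_derive t 1 (fun t => sin (w * t)) (w * cos (w * t)).
Proof.
have dw : is_derive t 1 (fun t : R => w * t) w.
  by apply: is_derive_eq; rewrite /GRing.scale /= mulr1.
apply: (is_derive_eq (is_derive1_comp (f := sin) _ dw)).
by rewrite mulrC.
Qed.

(** The form taken by a quadratic function along a great circle run at angular
speed w; this family is closed under differentiation. *)
Definition trig_poly (R : realType) (a b c d e k w t : R) : R :=
  a * cos (w * t) ^+ 2 + b * (cos (w * t) * sin (w * t)) +
  c * sin (w * t) ^+ 2 + d * cos (w * t) + e * sin (w * t) + k.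

Lemma is_derive_trig_poly (R : realType) (a b c d e k w t : R) :
  is_derive t 1 (trig_poly a b c d e k w)
    (trig_poly (w * b) (w * (2 * (c - a))) (- (w * b)) (w * e)
       (- (w * d)) 0 w t).
Proof.
have dc := is_derive_cosM w t; have ds := is_derive_sinM w t.
by rewrite /trig_poly; apply: is_derive_eq; rewrite /GRing.scale /=; ring.
Qed.

(** * The second-order condition for quadratic functions *)

Definition quadratic (R : realType) (n : nat) (A : 'M[R]_n) (b : 'cV[R]_n)
    (c : R) (x : 'cV[R]_n) : R := inner (A *m x) x + inner b x + c.

Lemma quadratic_unit_arc (R : realType) (n : nat) (A : 'M[R]_n)
    (b : 'cV[R]_n) (c : R) (p v : 'cV[R]_n) (w t : R) :
  quadratic A b c (unit_arc p v (w * t)) =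
  trig_poly (inner (A *m p) p) (inner (A *m p) v + inner (A *m v) p)
    (inner (A *m v) v) (inner b p) (inner b v) c w t.
Proof.
rewrite /quadratic /unit_arc /trig_poly mulmxDr -!scalemxAr.
by rewrite !(innerDl, innerDr, innerZl, innerZr); ring.
Qed.

(** With x the position and y the unit velocity at time t, the second derivative
of the function along an arc of speed w is w^2 times the difference of the two
sides of the assumed inequality. *)
Lemma spherically_convex_of_second_order (R : realType) (n : nat)
    (K : set 'cV[R]_n) (A : 'M[R]_n) (b : 'cV[R]_n) (c : R) :
  (forall x v, (sphere R n `&` interior K) x -> inner v v = 1 -> inner x v = 0 ->
    inner b x <= 2 * (inner (A *m v) v - inner (A *m x) x)) ->
  spherically_convex (sphere R n `&` interior K) (quadratic A b c).
Proof.
move=> hess J g [itvJ [w [w_ge0 [C [gcC [p [v [Cp Cv pv gE]]]]]] _]] gD.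
have pp := great_circle_sphere gcC Cp; have vv := great_circle_sphere gcC Cv.
have {}gE t : J t -> g t = unit_arc p v (w * t) by exact: gE.
have dF := is_derive_trig_poly (inner (A *m p) p)
  (inner (A *m p) v + inner (A *m v) p)
  (inner (A *m v) v) (inner b p) (inner b v) c w.
have dF1 := is_derive_trig_poly _ _ _ _ _ _ w.
apply: (convex_function_derive2 itvJ dF (dF1 _ _ _ _ _ _)) => t Jt; last first.
  by rewrite /= gE // quadratic_unit_arc.
set x := unit_arc p v (w * t); pose y := unit_arc v (-1 *: p) (w * t).
have Dx : (sphere R n `&` interior K) x by rewrite /x -gE //; exact: gD.
have yy : inner y y = 1.
  rewrite inner_unit_arc ?subrr ?cos0 ?innerZl ?innerZr ?pp //; first by ring.
  by rewrite innerC pv mulr0.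
have xy : inner x y = 0.
  rewrite /x /y /unit_arc !(innerDl, innerDr, innerZl, innerZr) pp vv.
  by rewrite (innerC v) pv; ring.
have := hess x y Dx yy xy.
rewrite -subr_ge0 => /(mulr_ge0 (sqr_ge0 w)); congr (0 <= _).
rewrite /x /y /unit_arc /trig_poly !mulmxDr -!scalemxAr.
by rewrite !(innerDl, innerDr, innerZl, innerZr); ring.
Qed.

Lemma unit_arc_near0 (R : realType) (n : nat) (K : set 'cV[R]_n)
    (x v : 'cV[R]_n) :
  interior K x -> \forall t \near (0 : R), interior K (unit_arc x v t).
Proof.
move=> Kx.
have cvg_arc : unit_arc x v t @[t --> (0 : R)] --> x.
  rewrite -[X in _ --> X](_ : unit_arc x v 0 = x); last first.
    by rewrite /unit_arc cos0 sin0 scale1r scale0r addr0.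
  apply: cvgD; apply: cvgZr_tmp; [exact: continuous_cos|exact: continuous_sin].
have : nbhs x (interior K).
  by apply: open_nbhs_nbhs; split=> //; exact: open_interior.
exact: cvg_arc.
Qed.

(** Midpoint convexity between the times u and -u, with the identity
sin^2 u = (1 - cos u) (1 + cos u), gives the inequality with the factor
1 + cos u in place of 2; then u tends to 0. *)
Lemma second_order_of_spherically_convex (R : realType) (n : nat)
    (K : set 'cV[R]_n) (A : 'M[R]_n) (b : 'cV[R]_n) (c : R) (x v : 'cV[R]_n) :
  spherically_convex (sphere R n `&` interior K) (quadratic A b c) ->
  (sphere R n `&` interior K) x -> inner v v = 1 -> inner x v = 0 ->
  inner b x <= 2 * (inner (A *m v) v - inner (A *m x) x).
Proof.
move=> cvxf [/sphereE xx Kx] vv xv.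
have /nbhs_ballP[e /= e_gt0 ballK] := unit_arc_near0 v Kx.
(* Staying below 1 makes the arc over ]-r, r[ shorter than 2 <= pi. *)
pose r := Num.min e 1; have r_gt0 : 0 < r by rewrite lt_min e_gt0 ltr01.
have r_pi : r + r <= pi.
  apply: le_trans (pi_ge2 R).
  have : r <= 1 by rewrite ge_min lexx orbT.
  lra.
pose J : set R := [set` `](- r), r[].
have geoJ : minimal_geodesic_segment J (unit_arc x v).
  apply: minimal_unit_arc => //; first exact: interval_is_interval.
  by move=> s t; rewrite /J /= !in_itv /=; lra.
have arcD t : J t -> (sphere R n `&` interior K) (unit_arc x v t).
  rewrite /J /= in_itv /= => /andP[rt tr]; split.
    by apply/sphereE; rewrite inner_unit_arc // subrr cos0.
  apply: ballK; rewrite /ball /= sub0r normrN.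
  have : `|t| < r by rewrite ltr_norml rt.
  by rewrite /r lt_min => /andP[].
have cvxJ := cvxf J _ geoJ arcD.
have bound u : 0 < u < r ->
    inner b x <= (1 + cos u) * (inner (A *m v) v - inner (A *m x) x).
  move=> /andP[u_gt0 ur].
  have Ju : u \in J by apply/mem_set; rewrite /J /= in_itv /=; lra.
  have JNu : - u \in J by apply/mem_set; rewrite /J /= in_itv /=; lra.
  have half_ge0 : 0 <= 2^-1 :> R by lra.
  have half_le1 : 2^-1 <= 1 :> R by lra.
  pose F t := quadratic A b c (unit_arc x v (1 * t)).
  have : F 0 <= 2^-1 * F u + (1 - 2^-1) * F (- u).
    have -> : 0 = 2^-1 * u + (1 - 2^-1) * - u by lra.
    by rewrite /F !mul1r; exact: (cvxJ (Itv01 half_ge0 half_le1) u (- u)).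
  rewrite /F !quadratic_unit_arc /trig_poly !mul1r cosN sinN cos0 sin0 => mid.
  have cos_lt1 : cos u < 1.
    by rewrite -cos0 ltr_cos // in_itv /=; lra.
  (* The midpoint inequality is the goal multiplied by 1 - cos u. *)
  rewrite -subr_ge0 -(pmulr_rge0 _ (_ : 0 < 1 - cos u)) ?subr_gt0 //.
  move: mid; rewrite sqrrN sin2cos2 -subr_ge0; congr (0 <= _).
  by field.
have cvg_bound : (1 + cos u) * (inner (A *m v) v - inner (A *m x) x)
    @[u --> (0 : R)^'+] --> 2 * (inner (A *m v) v - inner (A *m x) x).
  apply: cvgMr_tmp.
  have -> : (2 : R) = 1 + cos 0 by rewrite cos0; lra.
  apply: cvgD; first exact: cvg_cst.
  apply: cvg_at_right_filter; exact: continuous_cos.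
rewrite -(cvg_lim _ cvg_bound) //; apply: limr_ge.
  by apply/cvg_ex; eexists; exact: cvg_bound.
near=> u; apply: bound; apply/andP; split; first by [].
near: u; exact: nbhs_right_lt.
Unshelve. all: by end_near.
Qed.

(** * The open orthant and diagonal matrices *)

Lemma interior_orthant (R : realType) (n : nat) (x : 'cV[R]_n) :
  interior (orthant R n) x <-> forall i, 0 < x i 0.
Proof.
split=> [/nbhs_ballP[e /= e_gt0 ball_pos] i|x_gt0].
  have : orthant R n (\col_k (x k 0 - e / 2)).
    apply: ball_pos; split=> // k j; rewrite mxE ord1 /ball /=.
    by rewrite opprB addrC subrK gtr0_norm; lra.
  by move=> /(_ i); rewrite mxE; lra.
pose e := \big[Num.min/1]_i x i 0.
have e_gt0 : 0 < e by apply: lt_bigmin.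
apply/nbhs_ballP; exists e => // y [_ ball_xy] i.
have := ball_xy i 0; rewrite /ball /= => xy.
have exi : e <= x i 0 by exact: bigmin_le_cond.
by move: (ler_norm (x i 0 - y i 0)); lra.
Qed.

Lemma inner_delta (R : realType) (n : nat) (x : 'cV[R]_n) (i : 'I_n) :
  inner x (delta_mx i 0) = x i 0.
Proof.
rewrite innerE (bigD1 i) //= big1 ?addr0 ?mxE ?eqxx ?mulr1 // => j /negPf ji.
by rewrite mxE ji mulr0.
Qed.

Lemma inner_diag (R : realType) (n : nat) (d x y : 'cV[R]_n) :
  inner (diag_mx d^T *m x) y = \sum_i d i 0 * x i 0 * y i 0.
Proof. by rewrite innerE; apply: eq_bigr => i _; rewrite mul_diag_mx !mxE. Qed.

Lemma diag_delta (R : realType) (n : nat) (d : 'cV[R]_n) (i : 'I_n) :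
  diag_mx d^T *m delta_mx i 0 = d i 0 *: delta_mx i (0 : 'I_1).
Proof.
apply/matrixP => k j; rewrite mul_diag_mx !mxE ord1 eqxx andbT.
by case: eqP => [->|_]; rewrite ?mulr0.
Qed.

(** A double eigenvalue of diag(d) has a plane of eigenvectors, and every plane
contains a unit vector orthogonal to x: here x_j e_i - x_i e_j, normalised. *)
Lemma double_eigenvalue_orthogonal (R : realType) (n : nat) (d x : 'cV[R]_n)
    (i j : 'I_n) :
  d i 0 = d j 0 -> i != j -> x i 0 != 0 ->
  exists v, [/\ inner v v = 1, inner x v = 0 &
    inner (diag_mx d^T *m v) v = d i 0].
Proof.
move=> dij ij xi_neq0.
pose s := x i 0 ^+ 2 + x j 0 ^+ 2; pose r := Num.sqrt s.
have s_gt0 : 0 < s by rewrite ltr_wpDr ?sqr_ge0 // exprn_even_gt0.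
have r_neq0 : r != 0 by rewrite gt_eqF // sqrtr_gt0.
have rr : r * r = s by rewrite -expr2 sqr_sqrtr // ltW.
pose v : 'cV[R]_n := (x j 0 / r) *: delta_mx i 0 + (- x i 0 / r) *: delta_mx j 0.
have Av : diag_mx d^T *m v = d i 0 *: v.
  by rewrite mulmxDr -!scalemxAr !diag_delta scalerDr !scalerA -dij
             !(mulrC (d i 0)).
have vv : inner v v = 1.
  rewrite {2}/v innerDr !innerZr !inner_delta !mxE !eqxx (eq_sym j) (negPf ij) /=.
  transitivity (s / (r * r)); last by rewrite rr divff // gt_eqF.
  by rewrite /s; field.
exists v; split=> //; last by rewrite Av innerZl vv mulr1.
by rewrite innerDr !innerZr !inner_delta; field.
Qed.

Lemma sphere_orthant_coord (R : realType) (n : nat) (x : 'cV[R]_n) (i : 'I_n) :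
  (sphere R n `&` interior (orthant R n)) x -> 0 < x i 0 <= 1.
Proof.
move=> [/sphereE xx /interior_orthant x_gt0]; rewrite x_gt0 /=.
have : x i 0 ^+ 2 <= 1.
  rewrite -xx innerE expr2 (bigD1 i) //= lerDl.
  by rewrite sumr_ge0 // => j _; rewrite ltW ?mulr_gt0.
by have := x_gt0 i; nra.
Qed.

Lemma inner_diag_ge (R : realType) (n : nat) (d v : 'cV[R]_n) (m : R) :
  (forall i, m <= d i 0) -> inner v v = 1 -> m <= inner (diag_mx d^T *m v) v.
Proof.
move=> m_le vv; rewrite inner_diag -[leLHS]mulr1 -vv innerE mulr_sumr.
by apply: ler_sum => i _; rewrite -mulrA ler_wpM2r // -expr2 sqr_ge0.
Qed.

(** * Reduction to the coordinates of b *)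

Lemma coordinate_bound_sufficient (R : realType) (n : nat) (d b x : 'cV[R]_n)
    (m : R) :
  (forall i, m <= d i 0) -> (forall i, b i 0 <= 2 * (m - d i 0)) ->
  (sphere R n `&` interior (orthant R n)) x ->
  inner b x <= 2 * (m - inner (diag_mx d^T *m x) x).
Proof.
move=> m_le b_le Dx; have [/sphereE xx _] := Dx.
have -> : 2 * (m - inner (diag_mx d^T *m x) x) =
    \sum_i 2 * (m - d i 0) * x i 0 ^+ 2.
  rewrite inner_diag -[X in 2 * (X - _)]mulr1 -xx innerE mulr_sumr.
  rewrite -sumrB mulr_sumr; apply: eq_bigr => i _; ring.
rewrite innerE; apply: ler_sum => i _.
have /andP[xi_gt0 xi_le1] := sphere_orthant_coord i Dx.
apply: (@le_trans _ _ (2 * (m - d i 0) * x i 0)).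
  exact: (ler_wpM2r (ltW xi_gt0)).
rewrite ler_wnM2l //; first by have := m_le i; lra.
by rewrite expr2 -[leRHS]mulr1 ler_wpM2l // ltW.
Qed.

(** The basis vector e_i lies on the boundary of the orthant.  It is approached
along the great circle from e_i towards the normalised sum u of the other
basis vectors, which enters the open orthant at once. *)
Lemma coordinate_bound_necessary (R : realType) (n : nat) (d b : 'cV[R]_n)
    (m : R) :
  (2 <= n)%N ->
  (forall x, (sphere R n `&` interior (orthant R n)) x ->
    inner b x <= 2 * (m - inner (diag_mx d^T *m x) x)) ->
  forall i, b i 0 <= 2 * (m - d i 0).
Proof.
move=> n_ge2 bound i.
pose e : 'cV[R]_n := delta_mx i 0.
have ee : inner e e = 1 by rewrite inner_delta mxE !eqxx.
pose o : 'cV[R]_n := \col_j (j != i)%:R.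
pose s := inner o o; pose r := Num.sqrt s.
have s_gt0 : 0 < s.
  have [j ji] : exists j : 'I_n, j != i.
    apply/existsP; apply: contraLR n_ge2; rewrite negb_exists => /forallP all_i.
    rewrite -ltnNge ltnS -[X in (X <= _)%N]card_ord -(card1 i).
    apply: subset_leq_card; apply/fintype.subsetP => j _.
    by have := all_i j; rewrite negbK.
  rewrite /s innerE (bigD1 j) //= !mxE ji mulr1 ltr_wpDr //.
  by apply: sumr_ge0 => k _; rewrite !mxE mulr_ge0.
have r_gt0 : 0 < r by rewrite sqrtr_gt0.
pose u := r^-1 *: o.
have uu : inner u u = 1.
  rewrite innerZl innerZr mulrA -invfM -expr2 sqr_sqrtr ?ltW //.
  by rewrite mulVf // gt_eqF.
have eu : inner e u = 0.
  by rewrite innerC inner_delta !mxE eqxx mulr0.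
(* T is the difference of the two sides of the bound along this circle, seen as
   the quadratic function with matrix 2 diag(d), vector b and constant - 2 m. *)
pose T := trig_poly (inner ((2 *: diag_mx d^T) *m e) e)
  (inner ((2 *: diag_mx d^T) *m e) u + inner ((2 *: diag_mx d^T) *m u) e)
  (inner ((2 *: diag_mx d^T) *m u) u) (inner b e) (inner b u) (- (2 * m)) 1.
have TE t : T t =
    inner b (unit_arc e u t) -
    2 * (m - inner (diag_mx d^T *m unit_arc e u t) (unit_arc e u t)).
  rewrite /T -quadratic_unit_arc mul1r /quadratic -scalemxAl innerZl; ring.
have T0 : T 0 = b i 0 - 2 * (m - d i 0).
  rewrite TE /unit_arc cos0 sin0 scale1r scale0r addr0 diag_delta innerZl ee.
  by rewrite inner_delta mulr1.
have contT : T t @[t --> (0 : R)^'+] --> T 0.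
  apply: cvg_at_right_filter; apply: differentiable_continuous.
  apply/derivable1_diffP; apply: ex_derive; exact: is_derive_trig_poly.
rewrite -subr_le0 -T0 -(cvg_lim _ contT) //.
apply: limr_le; first by apply/cvg_ex; eexists; exact: contT.
near=> t; rewrite TE subr_le0; apply: bound; split.
  by apply/sphereE; rewrite inner_unit_arc // subrr cos0.
have t_gt0 : 0 < t by [].
have t_lt1 : t < 1 by near: t; exact: nbhs_right_lt.
have pi2 := pi_ge2 R.
have cost : 0 < cos t by apply: cos_gt0_pihalf; lra.
have sint : 0 < sin t by apply: sin_gt0_pi; lra.
apply/interior_orthant => j; rewrite !mxE eqxx andbT.
case: eqP => _ /=; rewrite !(mulr0, mulr1, addr0, add0r) //.
by rewrite mulr_gt0 // invr_gt0.
Unshelve. all: by end_near.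
Qed.

Theorem theorem5 (R : realType) (n : nat) (hn : (3 <= n)%N)
    (d : 'cV[R]_n) (i0 j0 : 'I_n)
    (hi0 : argmin d i0) (hj0 : argmin d j0) (hij : i0 <> j0)
    (b : 'cV[R]_n) (c : R) :
  let A : 'M[R]_n := diag_mx d^T in
  let f : 'cV[R]_n -> R := fun x => inner (A *m x) x + inner b x + c in
  spherically_convex (sphere R n `&` interior (orthant R n)) f <->
  (forall i : 'I_n,
     b i 0 <= 2 * (\big[Num.min/d i0 0]_(j < n) d j 0 - d i 0)).
Proof.
move=> A f; rewrite bigmin_eq_id; last by move=> j _; exact: hi0.
split=> [cvxf|b_le].
  apply: coordinate_bound_necessary (ltnW hn) _ => x Dx.
  have dij : d i0 0 = d j0 0 by apply/eqP; rewrite eq_le hi0 hj0.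
  have /andP[xi_gt0 _] := sphere_orthant_coord i0 Dx.
  have [|v [vv xv <-]] := double_eigenvalue_orthogonal dij _ (lt0r_neq0 xi_gt0).
    exact/eqP.
  exact: second_order_of_spherically_convex cvxf Dx vv xv.
apply: spherically_convex_of_second_order => x v Dx vv _.
apply: (le_trans (coordinate_bound_sufficient hi0 b_le Dx)).
by rewrite ler_pM2l // lerD2r inner_diag_ge.
Qed.
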